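(* If $m,n$ are integers with $3 \leq m \leq n$ and $m \equiv 1 \pmod{3}$, then $\mathrm{dom}_t(P_m \Box P_n) \leq \frac{(m+2)n}{3}+\frac{2(m+2)}{3}$.
   Context: An orientation of a (finite simple) graph $G$ is a digraph obtained by directing each edge $uv$ of $G$ in exactly one of the two directions $(u,v)$ or $(v,u)$. The orientation is valid if every vertex has in-degree at least $1$. A set $S\subseteq V(D)$ is a total dominating set of a digraph $D$ if every vertex of $D$ (including those in $S$) has an in-neighbor in $S$; $\gamma_t(D)$ is the minimum cardinality of a total dominating set of $D$. For a graph $G$ in which every component contains a cycle (equivalently, $G$ has a valid orientation), $\mathrm{dom}_t(G)$ is the minimum of $\gamma_t(D)$ over all valid orientations $D$ of $G$. $P_m$ is the path on $m$ vertices, and $G\Box H$ is the Cartesian product: vertex set $V(G)\times V(H)$, with $(g,h)$ adjacent to $(g',h')$ iff either $g=g'$ and $hh'\in E(H)$, or $gg'\in E(G)$ and $h=h'$. *)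

(* Defs.v *)
From HB Require Import structures.
From mathcomp Require Import all_boot all_order all_algebra.

Set Implicit Arguments.
Unset Strict Implicit.
Unset Printing Implicit Defensive.

Record sgraph := SGraph {
  vertex :> finType;
  adj : rel vertex;
  adj_sym : symmetric adj;
  adj_irrefl : irreflexive adj
}.

(* A digraph on T is given by its set of arcs; (u, v) is the arc from u to v. *)
Definition digraph (T : finType) := {set T * T}.

Definition orientation (G : sgraph) (D : digraph G) : bool :=
  [forall u : G, forall v : G,
     if adj u v then ((u, v) \in D) (+) ((v, u) \in D) else (u, v) \notin D].

Definition in_degree (T : finType) (D : digraph T) (v : T) : nat :=
  #|[set u | (u, v) \in D]|.

Definition valid_orientation (G : sgraph) (D : digraph G) : bool :=
  orientation D && [forall v : G, 1 <= in_degree D v].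

Definition total_dominating (T : finType) (D : digraph T) (S : {set T}) : bool :=
  [forall v : T, exists u in S, (u, v) \in D].

(* If some in-degree is 0 there is no total dominating set, and the value is
   the default #|T|. *)
Definition gamma_t (T : finType) (D : digraph T) : nat :=
  #|[arg min_(S < [set: T] | total_dominating D S) #|S|]|.

(* If G has no valid orientation, the value is the default gamma_t set0. *)
Definition dom_t (G : sgraph) : nat :=
  gamma_t [arg min_(D < (set0 : digraph G) | valid_orientation D) gamma_t D].

Section PathGraph.
Variable m : nat.

Definition path_adj : rel 'I_m :=
  fun i j => (i.+1 == j :> nat) || (j.+1 == i :> nat).

Lemma path_adj_sym : symmetric path_adj.
Proof. by move=> i j; rewrite /path_adj orbC. Qed.

Lemma path_adj_irrefl : irreflexive path_adj.
Proof. by move=> i; rewrite /path_adj orbb; apply/negbTE; rewrite gtn_eqF. Qed.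

Definition path_graph : sgraph := SGraph path_adj_sym path_adj_irrefl.

End PathGraph.

Section CartesianProduct.
Variables G H : sgraph.

Definition cart_adj : rel (G * H)%type := fun x y =>
  ((x.1 == y.1) && adj x.2 y.2) || (adj x.1 y.1 && (x.2 == y.2)).

Lemma cart_adj_sym : symmetric cart_adj.
Proof.
move=> x y; rewrite /cart_adj (eq_sym x.1) (eq_sym x.2).
by rewrite (adj_sym x.1) (adj_sym x.2).
Qed.

Lemma cart_adj_irrefl : irreflexive cart_adj.
Proof. by move=> x; rewrite /cart_adj !adj_irrefl andbF. Qed.

Definition cart_prod : sgraph := SGraph cart_adj_sym cart_adj_irrefl.

End CartesianProduct.

(* Main.v *)
Require Import Defs.
From mathcomp Require Import all_boot all_order all_algebra.
From mathcomp Require Import zify lra.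
Import GRing.Theory Num.Theory.
Local Open Scope ring_scope.

(** Choosing for every vertex [v] one in-neighbour [f v] that lies in [S]
    determines an orientation dominated by [S], provided that no edge is asked
    to point both ways, that is, [f (f v)] is never [v]; the edges left over are
    directed arbitrarily. So [dom_t G] is at most the size of any set that
    contains the range of such a map [f] ([dom_t_le]).

    Write [m = 3k + 1] and index the rows of the grid from [0]. The rows
    [3t + 1] with [t < k] are equal or adjacent to every row but the last.
    Each of these rows is dominated from its left end by a path directed to the
    right, and the two leftmost vertices of the row above it close a directed
    4-cycle from which that path starts. The row [3k - 1] is dominated by the
    row [3k - 2], and in turn dominates the last row [3k], so it needs no cycle
    of its own. This uses [k + 1] full rows and [k] pairs of extra vertices,
    which gives [(k + 1) n + 2 k] vertices ([dom_t_grid_le]), below the stated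
    [(k + 1) (n + 2)]. *)

(** [arg_min] falls back on its default only if there is no minimiser, hence never
    when the predicate is satisfiable, even if the default violates it. *)
Lemma arg_min_default {I : finType} (i0 i1 : I) (P : pred I) (F : I -> nat) :
  P i1 -> arg_min i0 P F = arg_min i1 P F.
Proof.
move=> Pi1; rewrite /arg_min /extremum; case: pickP => // no_min.
have [i Pi min_i] := @arg_minnP _ i1 P F Pi1.
have /negP[] := no_min i; rewrite /= Pi.
by apply/forallP => j; apply/implyP/min_i.
Qed.

Lemma gamma_t_le {T : finType} {D : digraph T} {S : {set T}} :
  total_dominating D S -> (gamma_t D <= #|S|)%N.
Proof.
move=> domS; rewrite /gamma_t (@arg_min_default _ _ S) //.
by case: arg_minnP => // S' _; apply.
Qed.

Lemma dom_t_le_gamma_t {G : sgraph} {D : digraph G} :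
  valid_orientation D -> (dom_t G <= gamma_t D)%N.
Proof.
move=> validD; rewrite /dom_t (@arg_min_default _ _ D) //.
by case: arg_minnP => // D' _; apply.
Qed.

(** The enumeration of the vertices directs the edges on which [f] imposes
    nothing. *)
Definition orient_by {G : sgraph} (f : G -> G) : digraph G :=
  [set e | adj e.1 e.2 &&
    ((f e.2 == e.1) || (f e.1 != e.2) && (enum_rank e.1 < enum_rank e.2)%N)].

(** The hypothesis [f (f v) != v] says that [f] never asks for both directions
    of an edge. *)
Lemma dom_t_le {G : sgraph} (f : G -> G) (S : {set G}) :
    (forall v, adj (f v) v) -> (forall v, f (f v) != v) ->
    (forall v, f v \in S) ->
  (dom_t G <= #|S|)%N.
Proof.
move=> adjf ff fS.
have arcf v : (f v, v) \in orient_by f by rewrite inE /= adjf eqxx.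
have valid : valid_orientation (orient_by f).
  apply/andP; split.
    apply/forallP => u; apply/forallP => v; rewrite !inE /= (adj_sym v u).
    case: ifP => [uv|-> //]; rewrite uv /=.
    have [<-|_] := eqVneq (f v) u; first by rewrite (negPf (ff v)).
    have [//|_ /=] := eqVneq (f u) v.
    case: ltngtP => // /ord_inj/enum_rank_inj uv_eq.
    by rewrite uv_eq adj_irrefl in uv.
  by apply/forallP => v; apply/card_gt0P; exists (f v); rewrite inE.
apply: leq_trans (dom_t_le_gamma_t valid) (gamma_t_le _).
by apply/forallP => v; apply/existsP; exists (f v); rewrite fS arcf.
Qed.

Local Open Scope nat_scope.

(** The in-neighbour chosen for the vertex in row [p.1] and column [p.2] of the
    grid with [3k + 1] rows. On the columns [0] and [1] of the rows [3t] and
    [3t + 1], with [t < k], it runs around a 4-cycle. *)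
Definition grid_pred (k : nat) (p : nat * nat) : nat * nat :=
  let: (i, j) := p in
  if i == 3 * k then (i.-1, j)
  else if i %% 3 == 0 then if j == 0 then (i, 1) else (i.+1, j)
  else if i %% 3 == 1 then if j == 0 then (i.-1, 0) else (i, j.-1)
  else (i.-1, j).

Section GridPred.

Variables (k i j : nat).
Hypotheses (k_gt0 : 0 < k) (i_le : i <= 3 * k).

Let q := grid_pred k (i, j).

Lemma grid_pred_bound n : 1 < n -> j < n -> (q.1 <= 3 * k) && (q.2 < n).
Proof. by rewrite /q /grid_pred => *; do !case: ifP => /=; lia. Qed.

Lemma grid_pred_adj :
  (q.1 == i) && ((q.2.+1 == j) || (j.+1 == q.2)) ||
  ((q.1.+1 == i) || (i.+1 == q.1)) && (q.2 == j).
Proof. by rewrite /q /grid_pred; do !case: ifP => /=; lia. Qed.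

Lemma grid_pred_asym : grid_pred k q != (i, j).
Proof.
by rewrite /q /grid_pred; do !case: ifP => /=; rewrite xpair_eqE; lia.
Qed.

Lemma grid_pred_range :
  (q.1 %% 3 == 1) || (q.1 == (3 * k).-1) ||
  [&& q.1 %% 3 == 0, q.1 < 3 * k & q.2 < 2].
Proof. by rewrite /q /grid_pred; do !case: ifP => /=; lia. Qed.

End GridPred.

Lemma dom_t_grid_le (k n : nat) : 0 < k -> 1 < n ->
  dom_t (cart_prod (path_graph (3 * k).+1) (path_graph n)) <= k.+1 * n + k * 2.
Proof.
move=> k_gt0; case: n => // n n_gt1.
set G := cart_prod _ _.
pose cell (p : nat * nat) : G := (inord p.1, inord p.2).
pose f (v : G) := cell (grid_pred k (val v.1, val v.2)).
have fE v : (val (f v).1, val (f v).2) = grid_pred k (val v.1, val v.2).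
  have := @grid_pred_bound k v.1 v.2 k_gt0 (ltn_ord v.1) _ n_gt1 (ltn_ord v.2).
  by rewrite /f; case: grid_pred => a b /= /andP[? ?]; rewrite !inordK.
(* For [t = k] the minimum is [3k - 1], the row that dominates the last one. *)
pose rows := [set cell (minn (3 * val p.1).+1 (3 * k).-1, val p.2)
               | p : 'I_k.+1 * 'I_n.+1].
pose pairs := [set cell (3 * val p.1, val p.2) | p : 'I_k * 'I_2].
have card_cover : #|rows :|: pairs| <= k.+1 * n.+1 + k * 2.
  apply: leq_trans (leq_card_setU _ _) _; apply: leq_add;
  by apply: leq_trans (leq_imset_card _ _) _; rewrite card_prod !card_ord.
apply: leq_trans (dom_t_le f _ _ _ _) card_cover.
- move=> v; have := @grid_pred_adj k v.1 v.2 k_gt0 (ltn_ord v.1).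
  by rewrite -fE.
- move=> v; have := @grid_pred_asym k v.1 v.2 k_gt0 (ltn_ord v.1).
  by rewrite -fE -fE; apply: contraNneq => ->.
- move=> v; have := @grid_pred_range k v.1 v.2 k_gt0 (ltn_ord v.1).
  rewrite -fE; case: (f v) => a b /= ab {v}.
  have cellE (i j : nat) : i = a -> j = b -> (a, b) = cell (i, j).
    by rewrite /cell => -> -> /=; rewrite !inord_val.
  have a_lt := ltn_ord a; rewrite inE; apply/orP.
  case/orP: ab => [a_row | /and3P[a_mod a_ltk b_lt2]]; [left | right].
    pose t := if a %% 3 == 1 then a %/ 3 else k.
    have t_lt : t < k.+1 by rewrite /t; case: ifP; lia.
    apply/imsetP; exists (Ordinal t_lt, b) => //; apply: cellE => //=.
    by rewrite /t; case: ifP a_row; lia.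
  have t_lt : a %/ 3 < k by lia.
  apply/imsetP; exists (Ordinal t_lt, Ordinal b_lt2) => //.
  by apply: cellE => //=; lia.
Qed.

Local Open Scope ring_scope.

Theorem corollary4p7 (m n : nat) (hm : (3 <= m)%N) (hmn : (m <= n)%N)
    (hmod : (m = 1 %[mod 3])%N) :
  ((dom_t (cart_prod (path_graph m) (path_graph n)))%:R : rat)
    <= ((m%:R + 2) * n%:R) / 3 + (2 * (m%:R + 2)) / 3.
Proof.
have [k k_gt0 def_m] : exists2 k, (0 < k)%N & m = (3 * k).+1.
  by exists (m %/ 3)%N; lia.
have n_gt1 : (1 < n)%N by lia.
rewrite {m hm hmn hmod}def_m.
have bound : (3 * dom_t (cart_prod (path_graph (3 * k).+1) (path_graph n))
               <= ((3 * k).+1 + 2) * n + 2 * ((3 * k).+1 + 2))%N.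
  by have := @dom_t_grid_le k n k_gt0 n_gt1; nia.
move: bound; rewrite -(ler_nat rat) !(natrM, natrD); lra.
Qed.
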